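(* For any polynomial $f(x)$ of degree $N$ with complex coefficients and any complex number $a$, $$f(x)=\sum_{k=0}^{N}(-1)^k q^{-\binom{k}{2}}\,\frac{\left(D_{p,q}^k f\right)(aq^{-k})}{[k]_{p,q}!}\,(a\ominus x)_{p,q}^k .$$
   Context: $p,q$ are nonzero complex numbers with $p^n\neq q^n$ for all integers $n\ge 1$. The $(p,q)$-derivative is $D_{p,q}f(x)=\dfrac{f(px)-f(qx)}{(p-q)x}$ for $x\neq 0$ and $(D_{p,q}f)(0)=f'(0)$ if $f$ is differentiable at $0$; $D_{p,q}^k$ is its $k$-fold iterate. $[n]_{p,q}=\dfrac{p^n-q^n}{p-q}$, $[n]_{p,q}!=\prod_{k=1}^{n}[k]_{p,q}$ for $n\ge 1$, $[0]_{p,q}!=1$. The $(p,q)$-power is $(u\ominus v)_{p,q}^n=(u-v)(pu-qv)\cdots(p^{n-1}u-q^{n-1}v)$ for $n\ge 1$ and $(u\ominus v)_{p,q}^0=1$. *)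

(* Defs.v *)
From mathcomp Require Import all_boot all_order all_algebra.
From mathcomp Require Import topology normedtype derive.

Set Implicit Arguments.
Unset Strict Implicit.
Unset Printing Implicit Defensive.

Import Order.TTheory GRing.Theory Num.Theory.
Import numFieldNormedType.Exports.

Local Open Scope ring_scope.

(* [derive1] is the derivative with respect to the field K itself, hence the
   complex derivative for K = R[i]. It is defined through a total limit
   operator, so the value at 0 is junk if f is not differentiable there. *)
Definition pq_derive (K : numFieldType) (p q : K) (f : K -> K) (x : K) : K :=
  if x == 0 then derive1 f 0 else (f (p * x) - f (q * x)) / ((p - q) * x).

Definition pq_num (K : numFieldType) (p q : K) (n : nat) : K :=
  (p ^+ n - q ^+ n) / (p - q).

Definition pq_fact (K : numFieldType) (p q : K) (n : nat) : K :=
  \prod_(1 <= k < n.+1) pq_num p q k.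

Definition pq_power (K : numFieldType) (p q u v : K) (n : nat) : K :=
  \prod_(0 <= i < n) (p ^+ i * u - q ^+ i * v).

(* Main.v *)
Require Import Defs.
From HB Require Import structures.
From mathcomp Require Import all_boot all_order all_algebra.
From mathcomp Require Import ring.
From mathcomp Require Import complex boolp functions reals.
From mathcomp Require Import topology normedtype derive.

Set Implicit Arguments.
Unset Strict Implicit.
Unset Printing Implicit Defensive.

Import Order.TTheory GRing.Theory Num.Theory.
Import numFieldNormedType.Exports.

Local Open Scope ring_scope.
Local Open Scope complex_scope.

(** The operator D = D_{p,q} acts on polynomials by X^n |-> [n] X^(n-1), and
    D (a - x)^n = - [n] q^(n-1) (a/q - x)^(n-1) for the (p,q)-power. Hence the
    derivative of the Taylor sum of f at a is the Taylor sum of D f at a/q,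
    which is D f by induction on the degree. Since [n] <> 0 for n > 0, two
    polynomials with the same image under D and the same value at a are equal,
    and all terms of the Taylor sum but the first vanish at a. *)

(** The predicate [is_derive] includes differentiability, so at 0 the total operator [derive1]
    returns the true derivative rather than a junk value. *)
Lemma is_derive_horner (K : numFieldType) (f : {poly K}) (x : K) :
  is_derive x 1 (horner f) (f^`()).[x].
Proof.
elim/poly_ind: f => [|f c IHf].
  rewrite deriv0 horner0.
  have -> : horner (0 : {poly K}) = cst 0 by apply/funext=> y; rewrite horner0.
  exact: is_derive_cst.
have -> : horner (f * 'X + c%:P) = horner f * id + cst c.
  by apply/funext=> y; rewrite !hornerE.
apply: is_derive_eq.
by rewrite derivMXaddC !hornerE /= /GRing.scale /=; ring.
Qed.

Lemma derive1_horner (K : numFieldType) (f : {poly K}) (x : K) :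
  derive1 (horner f) x = (f^`()).[x].
Proof. by rewrite derive1E; apply: derive_val; exact: is_derive_horner. Qed.

Lemma coef_comp_polyZX (K : comNzRingType) (c : K) (f : {poly K}) i :
  (f \Po (c *: 'X))`_i = c ^+ i * f`_i.
Proof.
rewrite coef_comp_poly.
under eq_bigr => j _ do rewrite exprZn coefZ coefXn.
have [lt_i | le_i] := ltnP i (size f).
  rewrite (bigD1 (Ordinal lt_i)) //= eqxx mulr1 big1 ?addr0 1?mulrC // => j.
  by rewrite -val_eqE eq_sym /= => /negPf->; rewrite !mulr0.
rewrite [f`_i]nth_default // mulr0 big1 // => j _.
by rewrite gtn_eqF ?mulr0 // (leq_trans (ltn_ord j)).
Qed.

(** Working on coefficients avoids the case split at 0 and makes linearity immediate;
    [pq_derive_horner] ties this operator to [pq_derive]. *)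
Definition pq_deriv (K : numFieldType) (p q : K) (f : {poly K}) : {poly K} :=
  \poly_(i < (size f).-1) (pq_num p q i.+1 * f`_i.+1).

Lemma coef_pq_deriv (K : numFieldType) (p q : K) (f : {poly K}) i :
  (pq_deriv p q f)`_i = pq_num p q i.+1 * f`_i.+1.
Proof.
rewrite coef_poly; case: ltnP => // le_i.
by rewrite nth_default ?mulr0 // (leq_trans (leqSpred _)).
Qed.

Fact pq_deriv_is_linear (K : numFieldType) (p q : K) : linear (pq_deriv p q).
Proof.
move=> c f g; apply/polyP=> i.
by rewrite !(coefD, coefZ, coef_pq_deriv); ring.
Qed.

HB.instance Definition _ (K : numFieldType) (p q : K) :=
  GRing.isLinear.Build K {poly K} {poly K} _ (pq_deriv p q)
    (pq_deriv_is_linear p q).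

(** The difference quotient without division, so that [(p - q) *: 'X] can be cancelled in the domain
    [{poly K}]. *)
Lemma pq_deriv_mulX (K : numFieldType) (p q : K) (f : {poly K}) : p != q ->
  ((p - q) *: 'X) * pq_deriv p q f = (f \Po (p *: 'X)) - (f \Po (q *: 'X)).
Proof.
move=> neq_pq; apply/polyP=> i.
rewrite -scalerAl coefZ coefXM coefB !coef_comp_polyZX -mulrBl.
case: i => [|i] /=; first by rewrite !expr0 subrr mul0r mulr0.
by rewrite coef_pq_deriv /pq_num mulrA [(p - q) * _]mulrC divfK // subr_eq0.
Qed.

(** Off 0, divide [pq_deriv_mulX] by (p - q) x. At 0 both sides are the coefficient of ['X], since
    [1] = 1. *)
Lemma pq_derive_horner (K : numFieldType) (p q : K) (f : {poly K}) : p != q ->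
  pq_derive p q (horner f) = horner (pq_deriv p q f).
Proof.
move=> neq_pq; have pq_neq0 : p - q != 0 by rewrite subr_eq0.
apply/funext=> x; rewrite /pq_derive; case: eqP => [->|/eqP x_neq0].
  rewrite derive1_horner !horner_coef0 coef_deriv coef_pq_deriv mulr1n.
  by rewrite /pq_num !expr1 divff // mul1r.
have /(congr1 (fun g => g.[x])) := pq_deriv_mulX f neq_pq.
rewrite !(hornerE, horner_comp) => <-.
by rewrite mulrC mulKf // mulf_neq0.
Qed.

Lemma iter_pq_derive_horner (K : numFieldType) (p q : K) k (f : {poly K}) :
  p != q ->
  iter k (pq_derive p q) (horner f) = horner (iter k (pq_deriv p q) f).
Proof.
by move=> neq_pq; elim: k => //= k ->; rewrite pq_derive_horner.
Qed.

Lemma pq_deriv_inj (K : numFieldType) (p q a : K) (f g : {poly K}) :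
  (forall n, (0 < n)%N -> p ^+ n != q ^+ n) ->
  pq_deriv p q f = pq_deriv p q g -> f.[a] = g.[a] -> f = g.
Proof.
move=> pq_neq eqD eq_a.
have /size1_polyC def_fg : (size (f - g)%R <= 1)%N.
  apply/leq_sizeP=> -[//|i] _; apply/eqP; rewrite coefB subr_eq0.
  have := congr1 (fun h : {poly K} => h`_i) eqD.
  rewrite !coef_pq_deriv => /mulfI -> //.
  (* The numerator of [i+1] is nonzero by the hypothesis at i+1, its denominator p - q by the
     hypothesis at 1. *)
  by rewrite mulf_neq0 ?invr_eq0 ?subr_eq0 ?pq_neq // (pq_neq 1).
apply/eqP; rewrite -subr_eq0 def_fg; apply/eqP; congr (_%:P).
by have /(congr1 (fun h => h.[a])) := def_fg; rewrite !hornerE eq_a subrr => <-.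
Qed.

Definition pq_powerX (K : numFieldType) (p q a : K) (n : nat) : {poly K} :=
  \prod_(0 <= i < n) ((p ^+ i * a)%:P - q ^+ i *: 'X).

Lemma horner_pq_powerX (K : numFieldType) (p q a x : K) n :
  (pq_powerX p q a n).[x] = pq_power p q a x n.
Proof.
by rewrite /pq_powerX horner_prod; apply: eq_bigr => i _; rewrite !hornerE.
Qed.

(** After multiplication by (p - q) X, the dilates by p and by q share the product of the p^i a -
    q^(i+1) X for i < n. The cofactors are p^n (a - p X) and p^n a - q^(n+1) X, whose difference is
    -(p^(n+1) - q^(n+1)) X. *)
Lemma pq_deriv_powerX (K : numFieldType) (p q a : K) n : p != q -> q != 0 ->
  pq_deriv p q (pq_powerX p q a n.+1)
    = (- (pq_num p q n.+1 * q ^+ n)) *: pq_powerX p q (a / q) n.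
Proof.
move=> neq_pq q_neq0; have pq_neq0 : p - q != 0 by rewrite subr_eq0.
apply: (@mulfI _ ((p - q) *: 'X)).
  by rewrite scaler_eq0 negb_or pq_neq0 polyX_eq0.
rewrite pq_deriv_mulX //.
have compE c : pq_powerX p q a n.+1 \Po (c *: 'X)
    = \prod_(0 <= i < n.+1) ((p ^+ i * a)%:P - (q ^+ i * c) *: 'X).
  rewrite /pq_powerX rmorph_prod; apply: eq_bigr => i _ /=.
  by rewrite comp_polyB comp_polyC comp_polyZ comp_polyX scalerA.
have scaleE c (F : nat -> {poly K}) :
    \prod_(0 <= i < n) (c *: F i) = c ^+ n *: \prod_(0 <= i < n) F i.
  by rewrite scaler_prod prodr_const_nat subn0.
(* The shared product: taking q out of each factor turns [a] into [a / q]. *)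
have powE : \prod_(0 <= i < n) ((p ^+ i * a)%:P - q ^+ i.+1 *: 'X)
    = q ^+ n *: pq_powerX p q (a / q) n.
  rewrite -scaleE; apply: eq_bigr => i _.
  rewrite scalerBr scalerA -exprS -[in RHS]mul_polyC -polyCM; congr (_%:P - _).
  by field.
(* The first factor is split off the dilate by p, the last one off the dilate by q. *)
rewrite !compE big_nat_recl // big_nat_recr //=.
have -> : \prod_(0 <= i < n) ((p ^+ i.+1 * a)%:P - (q ^+ i.+1 * p) *: 'X)
    = p ^+ n *: (q ^+ n *: pq_powerX p q (a / q) n).
  rewrite -powE -scaleE; apply: eq_bigr => i _.
  rewrite scalerBr scalerA [q ^+ _ * p]mulrC exprS -mulrA.
  by rewrite -[in RHS]mul_polyC -polyCM.
under [in X in _ - X]eq_bigr => i _ do rewrite -exprSr.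
rewrite powE -[in RHS]scalerAl -[in RHS]scalerAr !scalerA.
have -> : (p - q) * - (pq_num p q n.+1 * q ^+ n)
    = q ^+ n * (q ^+ n * q - p * p ^+ n).
  by rewrite /pq_num -exprS -exprSr; field.
rewrite -!mul_polyC !(polyCM, polyCB) !expr0; ring.
Qed.

Definition pq_taylor_coef (K : numFieldType) (p q a : K) (f : {poly K}) k : K :=
  (-1) ^+ k * q ^- 'C(k, 2)
  * ((iter k (pq_deriv p q) f).[a * q ^- k] / pq_fact p q k).

(** Here [k+1] cancels in the factorial, q^k cancels because C(k+1,2) = C(k,2) + k, the two signs
    cancel, and a q^-(k+1) = (a/q) q^-k. *)
Lemma pq_taylor_coefS (K : numFieldType) (p q a : K) (f : {poly K}) k :
  q != 0 -> pq_num p q k.+1 != 0 ->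
  pq_taylor_coef p q a f k.+1 * - (pq_num p q k.+1 * q ^+ k)
    = pq_taylor_coef p q (a / q) (pq_deriv p q f) k.
Proof.
move=> q_neq0 num_neq0; rewrite /pq_taylor_coef iterSr.
have -> : a * q ^- k.+1 = a / q * q ^- k by rewrite exprS invfM mulrA.
have -> : pq_fact p q k.+1 = pq_fact p q k * pq_num p q k.+1.
  by rewrite /pq_fact big_nat_recr.
move: (pq_num p q k.+1) num_neq0 => u u_neq0.
rewrite binS bin1 exprD [(-1) ^+ _.+1]exprS !invfM.
have qk_neq0 : q ^+ k != 0 by rewrite expf_neq0.
move: (horner _ _) (pq_fact _ _ _)^-1 (q ^- 'C(k, 2)) => d c e.
by field; rewrite u_neq0.
Qed.

Lemma pq_taylor (K : numFieldType) (p q a : K) n (f : {poly K}) :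
  q != 0 -> (forall k, (0 < k)%N -> p ^+ k != q ^+ k) -> (size f <= n)%N ->
  f = \sum_(0 <= k < n) pq_taylor_coef p q a f k *: pq_powerX p q a k.
Proof.
move=> q_neq0 pq_neq; have neq_pq : p != q := pq_neq 1 isT.
(* The base point must vary, as the induction hypothesis is used at [a / q]. A bound on the size,
   unlike an equation, also covers the zero polynomial. *)
elim: n f a => [|n IHn] f a.
  by rewrite leqn0 size_poly_eq0 big_nil => /eqP.
move=> size_f; apply: (pq_deriv_inj (a := a) pq_neq).
  have size_Df : (size (pq_deriv p q f) <= n)%N.
    by apply: leq_trans (size_poly _ _) _; rewrite -subn1 leq_subLR.
  rewrite [LHS](IHn _ (a / q) size_Df).
  rewrite big_nat_recl // linearD linearZ linear_sum /=.
  rewrite [pq_powerX p q a 0]big_nil.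
  (* The term k = 0 is killed, which shifts the index by one and aligns both sums. *)
  have -> : pq_deriv p q 1 = 0.
    by apply/polyP=> i; rewrite coef_pq_deriv coef1 coef0 mulr0.
  rewrite scaler0 add0r; apply: eq_bigr => k _.
  rewrite linearZ /= pq_deriv_powerX // scalerA pq_taylor_coefS //.
  by rewrite mulf_neq0 ?invr_eq0 ?subr_eq0 ?pq_neq.
rewrite big_nat_recl // hornerD hornerZ horner_pq_powerX horner_sum big1 => [|k _].
  rewrite /pq_taylor_coef /pq_fact /pq_power !big_nil bin0n /= !expr0 !invr1.
  by rewrite !mulr1 !mul1r addr0.
(* For positive exponents the factor of index 0 is a - a. *)
rewrite hornerZ horner_pq_powerX /pq_power big_nat_recl //.
by rewrite !expr0 subrr mul0r mulr0.
Qed.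

Theorem theorem4 (R : realType) (p q : R[i])
    (p_neq0 : p != 0) (q_neq0 : q != 0)
    (pq_neq : forall n : nat, (1 <= n)%N -> p ^+ n != q ^+ n)
    (N : nat) (f : {poly R[i]}) (degf : size f = N.+1) (a x : R[i]) :
  f.[x] = \sum_(0 <= k < N.+1)
    (-1) ^+ k * q ^- 'C(k, 2)
    * (iter k (pq_derive p q) (fun y => f.[y]) (a * q ^- k) / pq_fact p q k)
    * pq_power p q a x k.
Proof.
have size_f : (size f <= N.+1)%N by rewrite degf.
(* The expansion is an identity of polynomials; after evaluation at [x], iterates of [pq_deriv] are
   exchanged for those of [pq_derive]. *)
rewrite [f in LHS](pq_taylor a q_neq0 pq_neq size_f) horner_sum.
apply: eq_bigr => k _; rewrite hornerZ horner_pq_powerX /pq_taylor_coef.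
by rewrite (iter_pq_derive_horner k f (pq_neq 1 isT)).
Qed.
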